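(* Let $M=\begin{pmatrix} x_1 & x_2 & \cdots & x_n\\ y_1 & y_2 & \cdots & y_n\end{pmatrix}$ be a 1-prime $2\times n$ integer matrix ($n\ge 2$) with $\frac{y_{i-1}}{x_{i-1}}<\frac{y_i}{x_i}$ for $i=2,\dots,n$. Then for $\mathbf x=(x,y)^T\in\mathbb R^2$, $$T(\mathbf x|M)=\frac{1}{(n-2)!}\sum_{i=1}^n\frac{(y_ix-x_iy)_+^{\,n-2}}{\prod_{j\ne i}(y_ix_j-y_jx_i)},$$ where $(y_ix-x_iy)_+=y_ix-x_iy$ if $y_ix-x_iy\ge 0$ and $(y_ix-x_iy)_+=0$ otherwise.
   Context: The convex hull of the columns of $M$ is assumed not to contain the origin. A $2\times n$ integer matrix is 1-prime if for every choice of three of its columns spanning $\mathbb R^2$, the gcd of the absolute values of the nonzero $2\times2$ minors formed from these columns is $1$. The multivariate truncated power $T(\cdot|M)$ is the distribution on $\mathbb R^2$ given by $\phi\mapsto\int_{\mathbb R_{\ge0}^n}\phi(Mu)\,du$ for compactly supported infinitely differentiable $\phi$; when $n=2$ and $M$ is invertible it agrees with the function equal to $1/|\det M|$ on $\mathrm{cone}(M)$ (the set of nonnegative real combinations of the columns of $M$) and $0$ elsewhere.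
   Formalization: The formula is false on the interior of −cone(M), where T vanishes but the right-hand side does not; the formal statement asserts, as distributions on R², that T equals the formula outside −cone(M) and is 0 on −cone(M). *)

(* Defs.v *)
From HB Require Import structures.
From mathcomp Require Import all_boot all_order all_algebra.
From mathcomp Require Import all_classical all_reals all_analysis.

Set Implicit Arguments.
Unset Strict Implicit.
Unset Printing Implicit Defensive.

Import Order.TTheory GRing.Theory Num.Theory.
Import numFieldNormedType.Exports.
Local Open Scope classical_set_scope.
Local Open Scope ring_scope.

Section lebesgue_tuple.
Context (R : realType).

Definition tcons n (p : n.-tuple R * measurableTypeR R) : n.+1.-tuple R :=
  [tuple of (p.2 : R) :: p.1].

Lemma measurable_tcons n : measurable_fun setT (@tcons n).
Proof.
apply: (@measurable_cons _ _ _ _ (fun p : n.-tuple R * measurableTypeR R => p.2 : R));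
  last exact: measurable_fst.
exact: measurable_snd.
Qed.

(* n-dimensional Lebesgue measure: the n-fold product of [lebesgue_measure];
   R^0 is a single point of mass 1. The constant with the long name is the
   library's measure structure on [pushforward]. *)
Fixpoint lebesgue_tuple n : {measure set (n.-tuple R) -> \bar R} :=
  match n return {measure set (n.-tuple R) -> \bar R} with
  | 0 => dirac [tuple]
  | m.+1 => measure_function_pushforward__canonical__measure_function_Measure
              (lebesgue_tuple m \x @lebesgue_measure R)%E (@measurable_tcons m)
  end.

Definition lebesgue_plane :
    {measure set (measurableTypeR R * measurableTypeR R) -> \bar R} :=
  (@lebesgue_measure R \x @lebesgue_measure R)%E.

End lebesgue_tuple.

Section test_functions.
Context (R : realType).

(* All partial derivatives of order at most k exist and are continuous. *)
Fixpoint Ck (k : nat) (f : R * R -> R) : Prop :=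
  continuous f /\
  if k is k'.+1 then
    [/\ forall p, derivable f p (1, 0), forall p, derivable f p (0, 1),
        Ck k' (fun p => 'D_(1, 0) f p) & Ck k' (fun p => 'D_(0, 1) f p)]
  else True.

Definition test_function (f : R * R -> R) : Prop :=
  (forall k, Ck k f) /\ compact (closure [set p | f p != 0]).

End test_functions.

Section columns.
Context (n : nat) (M : 'M[int]_(2, n)).

Definition xcoord (i : 'I_n) : int := M 0 i.
Definition ycoord (i : 'I_n) : int := M 1 i.

Definition minor2 (i j : 'I_n) : int :=
  xcoord i * ycoord j - xcoord j * ycoord i.

(* A choice of three columns is an injection of 'I_3 into the indices; only the
   nonzero minors enter the gcd. *)
Definition one_prime : Prop :=
  forall f : 'I_3 -> 'I_n, injective f ->
    \rank (map_mx intr (colsub f M) : 'M[rat]_(2, 3)) = 2 ->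
    \big[gcdn/0%N]_(a < 3) \big[gcdn/0%N]_(b < 3 |
        (a < b)%N && (minor2 (f a) (f b) != 0)) `|minor2 (f a) (f b)|%N = 1%N.

Definition slope (i : 'I_n) : rat := (ycoord i)%:Q / (xcoord i)%:Q.

End columns.

Section truncated_power.
Context (R : realType) (n : nat) (M : 'M[int]_(2, n)).

Definition mulcol (u : 'I_n -> R) : R * R :=
  (\sum_i (xcoord M i)%:~R * u i, \sum_i (ycoord M i)%:~R * u i).

Definition convex_hull_columns : set (R * R) :=
  [set mulcol u | u in [set u | (forall i, 0 <= u i) /\ \sum_i u i = 1]].

Definition cone : set (R * R) :=
  [set mulcol u | u in [set u | forall i, 0 <= u i]].

Definition orthant : set (n.-tuple R) := [set u | forall i, 0 <= tnth u i].

(* The distribution T(.|M); the value is finite when the convex hull of the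
   columns avoids the origin. *)
Definition truncated_power (phi : R * R -> R) : \bar R :=
  (\int[lebesgue_tuple R n]_(u in orthant) (phi (mulcol (tnth u)))%:E)%E.

(* t_+^k, with the convention that t_+^0 is the indicator of t >= 0
   (it is not [(t_+) ^+ 0 = 1]). *)
Definition pos_power (t : R) (k : nat) : R := if 0 <= t then t ^+ k else 0.

(* On the interior of the opposite cone -cone M this equals
   (-1)^(n-1) * T(-p|M), which is nonzero although T(.|M) vanishes there; it
   can represent T(.|M) only on the complement of -cone M. *)
Definition truncated_power_formula (p : R * R) : R :=
  let x := p.1 in let y := p.2 in
  ((n - 2)`!%:R)^-1 *
  \sum_(i < n)
     pos_power ((ycoord M i)%:~R * x - (xcoord M i)%:~R * y) (n - 2)
     / \prod_(j < n | j != i)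
         (ycoord M i * xcoord M j - ycoord M j * xcoord M i)%:~R.

End truncated_power.

(* Main.v *)
Require Import Defs.
From HB Require Import structures.
From mathcomp Require Import all_boot all_order all_algebra.
From mathcomp Require Import all_classical all_reals all_analysis.
From mathcomp Require Import measurable_realfun ring lra.

(* Write F_n for the right-hand side as a function of the columns m_1, ..., m_n
   and let l be a linear form that is positive on the columns. The density of
   T(.|M) is G_n = F_n on {l > 0} and 0 elsewhere. For n = 2 this is a linear
   change of variables. Integrating out the coordinate of one more column m_0
   reduces the step to int_0^oo G_n(p - t m_0) dt = G_(n+1)(p): the integrand
   lives on 0 <= t < tau = l(p) / l(m_0), its primitive is
   - F_(n+1)(p - t m_0), and F_(n+1) vanishes at p - tau m_0. Indeed, on the part
   of {l <= 0} outside the opposite cone all det(p, m_i) have the same strict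
   sign: if it is negative every term of F is 0, and if it is positive F is a
   divided difference over n points of a form of degree n - 2, hence 0. The same
   vanishing replaces {l > 0} by the complement of the opposite cone.
   The identity is proved for nonnegative measurable functions, where Tonelli's
   theorem applies unconditionally, and then used on both parts of a test
   function. *)

Import Order.TTheory GRing.Theory Num.Theory.
Import numFieldNormedType.Exports.
Local Open Scope classical_set_scope.
Local Open Scope ring_scope.

(** * Determinants, divided differences and tournaments *)

Definition det2 (R : pzRingType) (p q : R * R) : R := p.1 * q.2 - p.2 * q.1.
Arguments det2 {R}.

Lemma det2xx (R : comPzRingType) (p : R * R) : det2 p p = 0.
Proof. by rewrite /det2 mulrC subrr. Qed.

Lemma det2C (R : comPzRingType) (p q : R * R) : det2 q p = - det2 p q.
Proof. by rewrite /det2; ring. Qed.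

(** Homogeneous form of the fact that a polynomial of degree k has zero divided difference over k +
    2 nodes: for [m i] = (1, x_i) the factors of the product are the differences x_i - x_j. The sum
    runs over a subset [A] because the induction on k deletes single nodes. *)
Lemma divided_difference_eq0 (F : fieldType) (I : finType) (m : I -> F * F)
    (p : F * F) (k : nat) (A : {set I}) :
  (forall i j, i != j -> det2 (m i) (m j) != 0) -> #|A| = k.+2 ->
  \sum_(i in A) det2 p (m i) ^+ k
     / \prod_(j in A | j != i) det2 (m j) (m i) = 0.
Proof.
move=> mneq0; elim: k A => [|k IHk] A cardA.
  have /cards2P[a [b [ab ->]]] : #|A| == 2 by rewrite cardA.
  rewrite big_setU1 ?inE//= big_set1 !expr0 !div1r.
  have -> : \prod_(j in [set a; b]%SET | j != a) det2 (m j) (m a) = det2 (m b) (m a).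
    rewrite (big_pred1 b)// => j; rewrite !inE.
    by case: (eqVneq j a) => //= [->|_]; rewrite ?andbT// (negbTE ab).
  have -> : \prod_(j in [set a; b]%SET | j != b) det2 (m j) (m b) = det2 (m a) (m b).
    rewrite (big_pred1 a)// => j; rewrite !inE.
    by case: (eqVneq j b) => //= [->|_]; rewrite ?andbT ?orbF// eq_sym (negbTE ab).
  by rewrite (det2C _ (m a)) invrN addNr.
have /card_gt1P[a [b [aA bA ab]]] : (1 < #|A|)%N by rewrite cardA.
have dab := mneq0 _ _ ab.
(* Cramer's rule [p = alpha (m a) + beta (m b)] splits each numerator in two,
   and each half is the identity for [A] with one element removed. *)
have wE i : det2 p (m i) = det2 p (m b) / det2 (m a) (m b) * det2 (m a) (m i)
                         + det2 (m a) p / det2 (m a) (m b) * det2 (m b) (m i).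
  by move: dab; rewrite /det2 => ?; field.
have half c : c \in A ->
    \sum_(i in A) det2 p (m i) ^+ k * det2 (m c) (m i)
      / \prod_(j in A | j != i) det2 (m j) (m i) = 0.
  move=> cA; rewrite (bigD1 c)//= det2xx mulr0 mul0r add0r.
  have := IHk (A :\ c)%SET; rewrite (cardsD1 c) cA in cardA.
  move/(_ (succn_inj cardA)) => {2}<-.
  apply: eq_big => [i|i /andP[iA ic]]; first by rewrite !inE andbC.
  (* The factor j = c of the product cancels against [det2 (m c) (m i)], leaving the product over
     [A] without c. *)
  rewrite [\prod_(j in A | _) _](bigD1 c)/=; last by rewrite cA eq_sym ic.
  rewrite invfM mulrA mulfK ?mneq0// 1?eq_sym//; congr (_ / _).
  apply: eq_bigl => j; rewrite !inE; case: (j == c) => //=; rewrite ?andbF//.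
  by rewrite andbT.
transitivity (det2 p (m b) / det2 (m a) (m b) *
  (\sum_(i in A) det2 p (m i) ^+ k * det2 (m a) (m i)
      / \prod_(j in A | j != i) det2 (m j) (m i))
  + det2 (m a) p / det2 (m a) (m b) *
  (\sum_(i in A) det2 p (m i) ^+ k * det2 (m b) (m i)
      / \prod_(j in A | j != i) det2 (m j) (m i))).
  rewrite !mulr_sumr -big_split/=; apply: eq_bigr => i iA.
  by rewrite exprSr {2}wE; ring.
by rewrite !half// !mulr0 addr0.
Qed.

(** A vertex of maximal out-degree works: by transitivity, a vertex j beating it would beat
    everything it beats and also the vertex itself, so j would have larger out-degree. *)
Lemma tournament_source (n : nat) (r : rel 'I_n.+1) :
  irreflexive r -> transitive r -> (forall i j, i != j -> r i j || r j i) ->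
  exists e, forall j, j != e -> r e j.
Proof.
move=> rxx rtr rtot.
pose e := [arg max_(i > ord0) #|[pred j | r i j]|]; exists e => j je.
rewrite /e; case: arg_maxnP => // i _ imax in e je *.
have /orP[rji|//] := rtot _ _ je; have /= := imax j isT; rewrite leqNgt.
move=> /negP; case; apply: proper_card; apply/properP; split.
  by apply/fintype.subsetP => x; rewrite !inE => /(rtr _ _ _ rji).
by exists i; rewrite !inE ?rxx.
Qed.

(** * Lebesgue measure on the line, on tuples and on the plane *)

(** Both sides are measures in [A], so by uniqueness of Lebesgue measure it suffices to compare them
    on intervals ]u, v]. A negative a reverses the interval, which moves the closed end but not the
    length. *)
Lemma pushforward_affine_lebesgue (R : realType) (a b : R) (A : set R) :
  a != 0 -> measurable A ->
  (`|a|%:E * lebesgue_measure ((fun t : R => a * t + b)%R @^-1` A)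
   = lebesgue_measure A)%E.
Proof.
move=> a0 mA.
have mf : measurable_fun setT ((fun t : R => a * t + b) : _ -> measurableTypeR R).
  by apply: measurable_realfun.measurable_funD => //; exact: measurable_funM.
have na0 : 0 <= `|a| by [].
pose mu := mscale (NngNum na0)
  (measure_function_pushforward__canonical__measure_function_Measure
    (@lebesgue_measure R) mf).
suff -> : lebesgue_measure A = mu A by [].
apply: (@lebesgue_measure_unique R mu) => // _ [[u v]] _ <-.
rewrite /mu/= /mscale/= /pushforward.
have [a_gt0|a_le0] := ltP 0 a.
  have -> : (fun t : R => a * t + b) @^-1` `]u, v] = `](u - b) / a, (v - b) / a]%classic.
    apply/seteqP; split => x; rewrite /preimage/= !in_itv/= ltr_pdivrMr// ler_pdivlMr//.
      by rewrite ltrBlDr lerBrDr mulrC.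
    by rewrite ltrBlDr lerBrDr mulrC.
  rewrite !lebesgue_measure_itv/= !lte_fin ltr_pM2r ?invr_gt0// ltrD2r.
  case: ifP => [uv|_]; last by rewrite mule0.
  by rewrite -EFinM gtr0_norm//; congr EFin; field; rewrite gt_eqF.
have a_lt0 : a < 0 by rewrite lt_neqAle a0.
have -> : (fun t : R => a * t + b) @^-1` `]u, v] = `[(v - b) / a, (u - b) / a[%classic.
  apply/seteqP; split => x; rewrite /preimage/= !in_itv/= ler_ndivrMr// ltr_ndivlMr//.
    by rewrite ltrBlDr lerBrDr andbC mulrC.
  by rewrite ltrBlDr lerBrDr andbC mulrC.
rewrite !lebesgue_measure_itv/= !lte_fin ltr_nM2r ?invr_lt0// ltrD2r.
case: ifP => [uv|_]; last by rewrite mule0.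
by rewrite -EFinM ltr0_norm//; congr EFin; field; rewrite lt_eqF.
Qed.

Lemma ge0_integral_affine (R : realType) (a b : R) (f : R -> \bar R) :
  a != 0 -> measurable_fun [set: R] f -> (forall t, 0 <= f t)%E ->
  (\int[lebesgue_measure]_t f t
   = `|a|%:E * \int[lebesgue_measure]_t f (a * t + b)%R)%E.
Proof.
move=> a0 mf f0.
have mg0 : measurable_fun [set: R] (fun t : R => a * t + b).
  by apply: measurable_realfun.measurable_funD => //; exact: measurable_funM.
pose g (t : measurableTypeR R) : measurableTypeR R := a * t + b.
have mg : measurable_fun setT g by exact: mg0.
have na0 : 0 <= `|a| by [].
have := @ge0_integral_pushforward _ _ _ _ R _ mg lebesgue_measure setT f
  measurableT mf (fun t _ => f0 t).
rewrite preimage_setT /= => <-.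
rewrite -(@ge0_integral_mscale _ _ _ _ _ measurableT (NngNum na0))//=.
apply: eq_measure_integral => // A mA _.
exact/esym/pushforward_affine_lebesgue.
Qed.

(* The sigma-finite structure that canonical inference finds on [m1 \x m2] is the
   one for subprobabilities, hence this explicit packing. *)
Section sigma_finite_alias.
Context d (T : measurableType d) (R : realType) (mu : {measure set T -> \bar R}).
Hypothesis mu_sigma_finite : sigma_finite setT mu.

Definition with_sigma_finite (_ : sigma_finite setT mu) : set T -> \bar R := mu.
Let m := with_sigma_finite mu_sigma_finite.

HB.instance Definition _ := Measure.on m.
HB.instance Definition _ :=
  Measure_isSigmaFinite.Build d T R m mu_sigma_finite.

Definition sigma_finite_pack : {sigma_finite_measure set T -> \bar R} := m.

End sigma_finite_alias.
Arguments sigma_finite_pack {d T R mu}.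

(** The exhaustions are taken nondecreasing so that the diagonal rectangles already cover the
    product: two indices are dominated by their maximum. *)
Lemma product_sigma_finite d1 d2 (T1 : measurableType d1)
    (T2 : measurableType d2) (R : realType)
    (m1 : {measure set T1 -> \bar R})
    (m2 : {sigma_finite_measure set T2 -> \bar R}) :
  sigma_finite setT m1 -> sigma_finite setT (m1 \x m2)%E.
Proof.
move=> /sigma_finiteP[F [TF ndF Foo]].
have /sigma_finiteP[G [TG ndG Goo]] := sigma_finiteT m2.
exists (fun k => F k `*` G k).
  apply/seteqP; split => // -[x y] _.
  have [i _ Fix] : (\bigcup_k F k) x by rewrite -TF.
  have [j _ Gjy] : (\bigcup_k G k) y by rewrite -TG.
  exists (maxn i j) => //; split.
    by move: Fix; exact/subsetPset/ndF/leq_maxl.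
  by move: Gjy; exact/subsetPset/ndG/leq_maxr.
move=> k; have [mF Fk] := Foo k; have [mG Gk] := Goo k.
split; first exact: measurableX.
by rewrite product_measure1E// lte_mul_pinfty// ge0_fin_numE.
Qed.

Lemma lebesgue_tuple_sigma_finite (R : realType) (n : nat) :
  sigma_finite setT (lebesgue_tuple R n).
Proof.
elim: n => [|n IHn].
  exists (fun=> setT); first by rewrite bigcup_const.
  by move=> _; split => //=; rewrite /dirac indicT/= ltry.
have [F TF mF] := @product_sigma_finite _ _ _ _ R _ (@lebesgue_measure R) IHn.
(* [g] inverts [tcons], so the preimage under [g] of a set of the product has the same measure as
   that set. *)
pose g (u : n.+1.-tuple R) : n.-tuple R * measurableTypeR R :=
  ([tuple of behead u], thead u).
have mg : measurable_fun setT g.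
  apply: measurable_fun_pair; first exact: measurable_behead.
  exact: measurable_tnth.
exists (fun k => g @^-1` F k).
  by rewrite -preimage_bigcup -TF preimage_setT.
move=> k; have [mFk Fk_fin] := mF k; split.
  by rewrite -[_ @^-1` _]setTI; exact: mg.
rewrite /= /pushforward.
have -> // : @tcons R n @^-1` (g @^-1` F k) = F k.
by apply/seteqP; split=> -[v t]; rewrite /preimage/= /g theadE /tcons/=;
  set w := [tuple of _]; have -> : w = v by apply/val_inj.
Qed.

Lemma integral_lebesgue_tuple0 (R : realType) (f : 0.-tuple R -> \bar R) :
  (\int[lebesgue_tuple R 0]_u f u = f [tuple])%E.
Proof.
have -> : f = cst (f [tuple]) by apply/funext => u; rewrite tuple0.
by rewrite integral_cst//= diracT mule1.
Qed.

Lemma ge0_integral_lebesgue_tupleS (R : realType) (n : nat)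
    (f : n.+1.-tuple R -> \bar R) :
  measurable_fun [set: n.+1.-tuple R] f -> (forall u, 0 <= f u)%E ->
  (\int[lebesgue_tuple R n.+1]_u f u
   = \int[lebesgue_tuple R n]_v \int[lebesgue_measure]_t f [tuple of t :: v])%E.
Proof.
move=> mf f0.
pose m1 : {sigma_finite_measure set (n.-tuple R) -> \bar R} :=
  sigma_finite_pack (@lebesgue_tuple_sigma_finite R n).
transitivity (\int[lebesgue_tuple R n \x @lebesgue_measure R]_p f (tcons p))%E.
  exact: (ge0_integral_pushforward (@measurable_tcons R n) _ measurableT mf
    (fun u _ => f0 u)).
exact: (@fubini_tonelli1 _ _ _ _ R m1 (@lebesgue_measure R) (f \o @tcons R n)
  (measurableT_comp mf (@measurable_tcons R n)) (fun=> f0 _)).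
Qed.

(** Measurability in the plane refers to the product sigma-algebra; an open set belongs to it as a
    countable union of squares with rational centre and radius. *)
Lemma open_plane_measurable (R : realType) (U : set (R * R)) :
  open U -> measurable U.
Proof.
move=> oU.
pose B (c : rat * rat * rat) : set (R * R) :=
  ball (ratr c.1.1 : R) (ratr c.2 : R) `*` ball (ratr c.1.2 : R) (ratr c.2 : R).
have mB c : measurable (B c).
  by apply: measurableX; exact: measurable_ball.
have -> : U = \bigcup_(c in [set c | B c `<=` U]) B c.
  apply/seteqP; split => [[x y] Uxy|p [c Bc /Bc]//].
  have /nbhs_ballP[e /= e0 eU] : nbhs (x, y) U by exact: open_nbhs_nbhs.
  have e40 : 0 < e / 4 by rewrite divr_gt0.
  have e2 : e / 4 < e / 2 by rewrite ltr_pM2l// ltf_pV2 ?posrE// ltr_nat.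
  (* The centre is within e/4 of the point and the radius lies between e/4 and e/2: the square
     contains the point and stays within 3e/4 of it. *)
  have [r /itvP rE] := rat_in_itvoo e2.
  have /rat_in_itvoo[p /itvP pE] : x - e / 4 < x + e / 4 by lra.
  have /rat_in_itvoo[q /itvP qE] : y - e / 4 < y + e / 4 by lra.
  have xp : `|ratr p - x| < e / 4 by rewrite ltr_distl !pE.
  have yq : `|ratr q - y| < e / 4 by rewrite ltr_distl !qE.
  have rl : e / 4 < ratr r by rewrite rE.
  have ru : ratr r < e / 2 by rewrite rE.
  exists (p, q, r).
    have tri (c z z' : R) : `|c - z| < e / 4 -> ball c (ratr r : R) z' -> ball z e z'.
      rewrite -ball_normE/= !ltr_distl => /andP[? ?] /andP[? ?].
      by apply/andP; split; lra.
    by move=> [x' y'] [/= Bx By]; apply: eU; split; [exact: tri xp _|exact: tri yq _].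
  by split => /=; rewrite -ball_normE/=; apply: lt_trans rl.
rewrite bigcup_mkcond.
apply: countable_bigcupT_measurable; first exact: countableP.
by move=> c; case: ifP.
Qed.

Lemma continuous_plane_measurable (R : realType) (f : R * R -> R) :
  continuous f -> measurable_fun [set: R * R] f.
Proof.
move=> cf; apply: (measurability _ (RGenOpens.measurableE R)).
move=> _ [_ [a [b ->] <-]]; rewrite setTI.
by apply: open_plane_measurable; apply: open_comp => //= x _; exact: cf.
Qed.

Lemma measurable_affine_plane (R : realType) (a b c a' b' c' : R) :
  measurable_fun [set: R * R]
    (fun q : R * R => (a * q.1 + b * q.2 + c, a' * q.1 + b' * q.2 + c')).
Proof.
by apply: measurable_fun_pair;
  apply: measurable_realfun.measurable_funD => //;
  apply: measurable_realfun.measurable_funD => //; exact: measurable_funM.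
Qed.

Lemma measurable_plane_line (R : realType) (f : R * R -> \bar R) :
  measurable_fun [set: R * R] f ->
  (forall x, measurable_fun [set: R] (fun y => f (x, y))) /\
  (forall y, measurable_fun [set: R] (fun x => f (x, y))).
Proof.
move=> mf; split => z.
  exact: (measurableT_comp mf (pair1_measurable z)).
exact: (measurableT_comp mf (pair2_measurable z)).
Qed.

Lemma measurable_plane_integral (R : realType) (f : R * R -> \bar R) :
  measurable_fun [set: R * R] f -> (forall p, 0 <= f p)%E ->
  measurable_fun [set: R] (fun x => \int[lebesgue_measure]_y f (x, y))%E /\
  measurable_fun [set: R] (fun y => \int[lebesgue_measure]_x f (x, y))%E.
Proof.
move=> mf f0; split.
  exact: (@measurable_fun_fubini_tonelli_F _ _ _ _ R (@lebesgue_measure R) f mf f0).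
exact: (@measurable_fun_fubini_tonelli_G _ _ _ _ R (@lebesgue_measure R) f mf f0).
Qed.

Lemma ge0_integral_plane (R : realType) (f : R * R -> \bar R) :
  measurable_fun [set: R * R] f -> (forall p, 0 <= f p)%E ->
  (\int[lebesgue_plane R]_p f p
   = \int[lebesgue_measure]_x \int[lebesgue_measure]_y f (x, y))%E.
Proof.
move=> mf f0.
exact: (@fubini_tonelli1 _ _ _ _ R (@lebesgue_measure R) (@lebesgue_measure R) f mf f0).
Qed.

Lemma ge0_integral_plane_swap (R : realType) (f : R * R -> \bar R) :
  measurable_fun [set: R * R] f -> (forall p, 0 <= f p)%E ->
  (\int[lebesgue_measure]_x \int[lebesgue_measure]_y f (x, y)
   = \int[lebesgue_measure]_y \int[lebesgue_measure]_x f (x, y))%E.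
Proof.
move=> mf f0.
exact: (@fubini_tonelli _ _ _ _ R (@lebesgue_measure R) (@lebesgue_measure R) f mf f0).
Qed.

Lemma ge0_integral_plane_translate (R : realType) (v : R * R)
    (f : R * R -> \bar R) :
  measurable_fun [set: R * R] f -> (forall p, 0 <= f p)%E ->
  (\int[lebesgue_plane R]_p f p
   = \int[lebesgue_plane R]_p f (p.1 + v.1, p.2 + v.2)%R)%E.
Proof.
move=> mf f0.
have mfv : measurable_fun [set: R * R] (fun p : R * R => f (p.1 + v.1, p.2 + v.2)%R).
  have := measurableT_comp mf (@measurable_affine_plane R 1 0 v.1 0 1 v.2).
  by congr measurable_fun; apply/funext => p /=; rewrite !mul1r !mul0r addr0 add0r.
rewrite !ge0_integral_plane// (@ge0_integral_affine R 1 v.1)//=.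
- rewrite normr1 mul1e; apply: eq_integral => x _.
  rewrite (@ge0_integral_affine R 1 v.2)//= ?normr1 ?mul1e ?mul1r.
  + by apply: eq_integral => y _; rewrite !mul1r.
  + exact: ((measurable_plane_line _ _ mf).1 (x + v.1)).
- exact: (measurable_plane_integral _ _ mf f0).1.
- by move=> x; apply: integral_ge0.
Qed.

(** The substitution is factored into one-variable affine ones: first y = (D / p.1) s + (p.2 / p.1)
    x at fixed x, then, after exchanging the integrals, x = p.1 t + s q.1 at fixed s. The two
    scaling factors D / p.1 and p.1 multiply to D. *)
Lemma ge0_integral_plane_linear (R : realType) (p q : R * R)
    (f : R * R -> \bar R) :
  p.1 != 0 -> det2 p q != 0 ->
  measurable_fun [set: R * R] f -> (forall p, 0 <= f p)%E ->
  (\int[lebesgue_plane R]_z f z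
   = `|det2 p q|%:E * \int[lebesgue_measure]_s \int[lebesgue_measure]_t
       f (t * p.1 + s * q.1, t * p.2 + s * q.2)%R)%E.
Proof.
move=> p10 D0 mf f0; set D := det2 p q in D0 *.
rewrite ge0_integral_plane//.
pose g (z : R * R) : \bar R := f (z.1, D / p.1 * z.2 + p.2 / p.1 * z.1).
have mg : measurable_fun [set: R * R] g.
  have := measurableT_comp mf (@measurable_affine_plane R 1 0 0 (p.2 / p.1) (D / p.1) 0).
  by congr measurable_fun; apply/funext => z /=; rewrite /g mul1r mul0r !addr0 addrC.
have g0 z : (0 <= g z)%E by exact: f0.
transitivity (\int[lebesgue_measure]_x (`|D / p.1|%:E * \int[lebesgue_measure]_s g (x, s)))%E.
  apply: eq_integral => x _.
  rewrite (@ge0_integral_affine R (D / p.1) (p.2 / p.1 * x))//.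
    by rewrite mulf_neq0// invr_eq0.
  exact: ((measurable_plane_line _ _ mf).1 x).
rewrite ge0_integralZl//=; last 2 first.
- exact: (measurable_plane_integral _ _ mg g0).1.
- by move=> x _; apply: integral_ge0.
rewrite (ge0_integral_plane_swap _ _ mg g0).
have -> : `|D| = `|D / p.1| * `|p.1| by rewrite -normrM divfK.
rewrite EFinM -muleA; congr (_ * _)%E.
pose h (z : R * R) : \bar R := f (z.1 * p.1 + z.2 * q.1, z.1 * p.2 + z.2 * q.2).
have mh : measurable_fun [set: R * R] h.
  have := measurableT_comp mf (@measurable_affine_plane R p.1 q.1 0 p.2 q.2 0).
  by congr measurable_fun; apply/funext => z /=; rewrite /h !addr0 ![_ * z.1]mulrC ![_ * z.2]mulrC.
have h0 z : (0 <= h z)%E by exact: f0.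
rewrite -ge0_integralZl//=; last 2 first.
- exact: (measurable_plane_integral _ _ mh h0).2.
- by move=> x _; apply: integral_ge0 => t _; exact: f0.
apply: eq_integral => s _.
rewrite (@ge0_integral_affine R p.1 (s * q.1))//; last first.
  exact: ((measurable_plane_line _ _ mg).2 s).
congr (_ * _)%E; apply: eq_integral => t _; rewrite /g /=; congr (f (_, _)).
  by rewrite mulrC.
by rewrite /D /det2; field.
Qed.

(** The integrands differ at most at the null set t = 0. This reconciles the closed orthant with the
    half-open cone on which the two-column formula is nonzero. *)
Lemma ge0_integral_half_line (R : realType) (f : R -> \bar R) :
  measurable_fun [set: R] f ->
  (\int[lebesgue_measure]_t (if (0 <= t)%R then f t else 0)
   = \int[lebesgue_measure]_t (if (0 < t)%R then f t else 0))%E.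
Proof.
move=> mf.
transitivity (\int[lebesgue_measure]_(t in `[0%R, +oo[) f t)%E.
  rewrite [RHS]integral_mkcond; apply: eq_integral => t _; rewrite patchE.
  by rewrite mem_setE in_itv/= andbT.
rewrite -integral_itv_obnd_cbnd; last exact: measurable_funTS.
rewrite [LHS]integral_mkcond; apply: eq_integral => t _; rewrite patchE.
by rewrite mem_setE in_itv/= andbT.
Qed.

(** * The truncated power formula for real vectors *)

Lemma measurable_pos_power (R : realType) (k : nat) :
  measurable_fun [set: R] (fun t : R => pos_power t k).
Proof.
by apply: measurable_fun_ifT => //; exact: measurable_fun_ler.
Qed.

Lemma pos_power_ge0 (R : realType) (t : R) (k : nat) : 0 <= pos_power t k.
Proof. by rewrite /pos_power; case: ifP => // t0; rewrite exprn_ge0. Qed.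

Lemma pos_powerS_le0 (R : realType) (t : R) (k : nat) :
  t <= 0 -> pos_power t k.+1 = 0.
Proof.
rewrite /pos_power; case: ifP => // t0 t0'.
by have -> : t = 0 by [apply/eqP; rewrite eq_le t0 t0']; rewrite expr0n.
Qed.

Lemma measurable_pos_power_affine (R : realType) (k : nat) (w d : R) :
  measurable_fun [set: R] (fun t : R => pos_power (w - t * d) k).
Proof.
apply: (measurableT_comp (@measurable_pos_power R k)).
by apply: measurable_funB => //; exact: measurable_funM.
Qed.

(** An affine function with endpoint values of the same sign keeps that sign in between, so the
    integrand is either zero or a polynomial with an explicit primitive. *)
Lemma integral_pos_power_same_sign (R : realType) (k : nat) (w d a b : R) :
  d != 0 -> a < b ->
  (0 <= w - a * d /\ 0 <= w - b * d) \/ (w - a * d <= 0 /\ w - b * d <= 0) ->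
  (\int[lebesgue_measure]_(t in `[a, b]) (pos_power (w - t * d) k)%:E
   = ((pos_power (w - a * d) k.+1 - pos_power (w - b * d) k.+1)
       / (k.+1%:R * d))%:E)%E.
Proof.
move=> d0 ab.
have mpf : measurable_fun `]a, b[ (fun t : R => pos_power (w - t * d) k).
  by apply: measurable_funTS; exact: measurable_pos_power_affine.
have between t : a < t < b ->
    w - t * d = (t - a) / (b - a) * (w - b * d) + (b - t) / (b - a) * (w - a * d).
  by move=> _; field; rewrite subr_eq0 gt_eqF.
have weight t : a < t < b -> 0 < (t - a) / (b - a) /\ 0 < (b - t) / (b - a).
  by move=> /andP[at_ tb]; rewrite !divr_gt0// subr_gt0.
case=> -[wa wb]; last first.
  (* Only interior points are compared: for k = 0 the integrand is 1 at an endpoint where w - t * d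
     vanishes. *)
  rewrite (@eq_integral_itv_bounded _ _ _ (cst 0)) => //.
    by rewrite integral0 !pos_powerS_le0// subrr mul0r.
  move=> t; rewrite in_itv/= => tab; rewrite /pos_power ifF//.
  apply/negbTE; rewrite -ltNge between//; have [u v] := weight _ tab.
  (* The endpoint values differ, hence are not both 0, and their convex combination is strictly
     negative. *)
  have : w - a * d != w - b * d by apply/eqP; move: d0 ab => /eqP d0 ab ?; apply: d0; nra.
  by move=> /eqP ?; nra.
pose P : {poly R} := - (k.+1%:R * d)^-1 *: (w%:P - d *: 'X) ^+ k.+1.
have kd0 : k.+1%:R * d != 0 by rewrite mulf_neq0// pnatr_eq0.
have PE t : P.[t] = - (k.+1%:R * d)^-1 * (w - t * d) ^+ k.+1.
  by rewrite /P !hornerE /= [d * t]mulrC.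
have P'E t : P^`().[t] = (w - t * d) ^+ k.
  rewrite /P derivZ deriv_exp derivB derivC derivZ derivX hornerZ hornerMn.
  rewrite hornerM horner_exp !hornerE/= [d * t]mulrC.
  rewrite -[(_ * _) *+ k.+1]mulr_natr; move: kd0; rewrite mulf_eq0 negb_or.
  by move: k.+1%:R => K /andP[? ?]; field; apply/andP; split.
rewrite (@eq_integral_itv_bounded _ _ _ (horner P^`())) => //.
- rewrite (@continuous_FTC2 _ _ (horner P))//.
  + rewrite !PE /pos_power wa wb -EFinB; congr EFin.
    by rewrite mulrC [_ * (_ ^+ _)]mulrC -mulrBl mulrN -mulNr opprB.
  + by apply: continuous_subspaceT; exact: continuous_horner.
  + split=> [t _||]; first exact: derivable_horner.
    * by apply: cvg_at_right_filter; exact: continuous_horner.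
    * by apply: cvg_at_left_filter; exact: continuous_horner.
  + by move=> t _; rewrite -derivE.
- by apply: measurable_funTS; apply: continuous_measurable_fun; exact: continuous_horner.
- move=> t; rewrite in_itv/= => tab; rewrite P'E /pos_power ifT//.
  by rewrite between//; have [u v] := weight _ tab; nra.
Qed.

(** A sign change inside the interval is removed by cutting at the zero c = w / d; the values of the
    primitive at c cancel. *)
Lemma integral_pos_power (R : realType) (k : nat) (w d a b : R) :
  d != 0 -> a < b ->
  (\int[lebesgue_measure]_(t in `[a, b]) (pos_power (w - t * d) k)%:E
   = ((pos_power (w - a * d) k.+1 - pos_power (w - b * d) k.+1)
       / (k.+1%:R * d))%:E)%E.
Proof.
move=> d0 ab.
have [opp|same] := ltP ((w - a * d) * (w - b * d)) 0; last first.
  apply: integral_pos_power_same_sign => //.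
  have [wa|wa] := leP 0 (w - a * d); have [wb|wb] := leP 0 (w - b * d); 
    [by left| |  |by right; split; exact: ltW].
  - by have [wa0|wa0] := eqVneq (w - a * d) 0; [right|left]; split; nra.
  - by have [wb0|wb0] := eqVneq (w - b * d) 0; [right|left]; split; nra.
pose c := w / d.
have wE : w = c * d by rewrite /c divfK.
have wc : w - c * d = 0 by rewrite wE subrr.
have {}opp : (c - a) * (c - b) < 0.
  have d2 : 0 < d ^+ 2 by rewrite exprn_even_gt0.
  by move: opp; rewrite wE; nra.
have [ac cb] : a < c /\ c < b by split; nra.
rewrite (@itv_bndbnd_setU _ _ _ (BRight c))// ?bnd_simp ?(ltW ac) ?(ltW cb)//.
rewrite integral_setU//=.
- rewrite integral_itv_obnd_cbnd; last first.
    apply: measurable_funTS; apply/measurable_EFinP; exact: measurable_pos_power_affine.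
  rewrite !integral_pos_power_same_sign// ?wc -?EFinD.
  + by congr EFin; rewrite -mulrDl addrA subrK.
  + by have [u|/ltW u] := leP 0 (w - a * d); [left|right]; split.
  + by have [u|/ltW u] := leP 0 (w - b * d); [left|right]; split.
- apply: measurable_funTS; apply/measurable_EFinP; exact: measurable_pos_power_affine.
- apply/disj_setPS => t /= []; rewrite !in_itv/= => /andP[_ tc] /andP[ct _].
  by move: (lt_le_trans ct tc); rewrite ltxx.
Qed.

Lemma integrable_pos_power (R : realType) (k : nat) (w d a b : R) :
  d != 0 -> a < b ->
  lebesgue_measure.-integrable `[a, b] (fun t => (pos_power (w - t * d) k)%:E).
Proof.
move=> d0 ab; apply/integrableP; split.
  by apply: measurable_funTS; apply/measurable_EFinP; exact: measurable_pos_power_affine.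
under eq_integral => t _ do rewrite gee0_abs ?lee_fin ?pos_power_ge0//.
by rewrite integral_pos_power// ltry.
Qed.

Definition dot2 (R : pzRingType) (l p : R * R) : R := l.1 * p.1 + l.2 * p.2.
Arguments dot2 {R}.

Definition translate2 (R : pzRingType) (p v : R * R) (t : R) : R * R :=
  (p.1 + t * v.1, p.2 + t * v.2).
Arguments translate2 {R}.

(** This is [truncated_power_formula] for real columns, the F_n of the idea; [det2 (m j) (m i)] is
    y_i x_j - y_j x_i. *)
Definition spline (R : realType) (n : nat) (m : 'I_n -> R * R) (p : R * R) : R :=
  ((n - 2)`!%:R)^-1 * \sum_(i < n) pos_power (det2 p (m i)) (n - 2)
     / \prod_(j < n | j != i) det2 (m j) (m i).
Arguments spline {R n}.

Section spline.
Context (R : realType).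

Lemma spline_same_side (n : nat) (m : 'I_n.+2 -> R * R) (p : R * R) :
  (forall i j, i != j -> det2 (m i) (m j) != 0) ->
  (forall i, 0 < det2 p (m i)) \/ (forall i, det2 p (m i) < 0) ->
  spline m p = 0.
Proof.
move=> mneq0 side; rewrite /spline; apply/eqP; rewrite mulf_eq0; apply/orP; right.
apply/eqP; case: side => side; last first.
  by rewrite big1// => i _; rewrite /pos_power leNgt side mul0r.
have := @divided_difference_eq0 R 'I_n.+2 m p n [set: 'I_n.+2]%SET mneq0.
rewrite cardsT card_ord => /(_ erefl) lag; rewrite -[RHS]lag.
apply: eq_big => [i|i _]; first by rewrite inE.
rewrite /pos_power ltW// subn2/=; congr (_ / _).
by apply: eq_bigl => j; rewrite inE.
Qed.

(** If the signs are mixed, there are i and j with det(p, m_i) <= 0 <= det(p, m_j). Cramer's rule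
    then writes - p in the basis m_i, m_j with two coefficients of the same weak sign, and l(- p) >=
    0 rules out that one of them is negative. *)
Lemma opposite_cone_or_same_side (n : nat) (m : 'I_n.+2 -> R * R) (l p : R * R) :
  (forall i j, i != j -> det2 (m i) (m j) != 0) ->
  (forall i, 0 < dot2 l (m i)) -> dot2 l p <= 0 ->
  (forall i, 0 < det2 p (m i)) \/ (forall i, det2 p (m i) < 0) \/
  exists i j a b, [/\ i != j, 0 <= a, 0 <= b &
    - p = (a * (m i).1 + b * (m j).1, a * (m i).2 + b * (m j).2)].
Proof.
move=> mneq0 l0 lp.
have [/forallP|] := boolP [forall i, 0 < det2 p (m i)]; first by left.
rewrite negb_forall => /existsP[i0]; rewrite -leNgt => i0P.
have [/forallP|] := boolP [forall i, det2 p (m i) < 0]; first by right; left.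
rewrite negb_forall => /existsP[j0]; rewrite -leNgt => j0P.
right; right.
have [i [j [ij iP jP]]] :
    exists i j, [/\ i != j, det2 p (m i) <= 0 & 0 <= det2 p (m j)].
  (* If both witnesses coincide, the determinant there is 0, so this index can be paired with any
     other one, on whichever side is left. *)
  have [ij|ij] := eqVneq i0 j0; last by exists i0, j0.
  have [k ki0] : exists k : 'I_n.+2, k != i0.
    by exists (lift i0 ord0); rewrite eq_sym neq_lift.
  have [kP|/ltW kP] := leP 0 (det2 p (m k)); first by exists i0, k; rewrite eq_sym.
  by exists k, i0; rewrite -ij in j0P.
set D := det2 (m i) (m j); have D0 : D != 0 by exact: mneq0.
exists i, j, (- det2 p (m j) / D), (det2 p (m i) / D).
have pE : - p = (- det2 p (m j) / D * (m i).1 + det2 p (m i) / D * (m j).1,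
                 - det2 p (m j) / D * (m i).2 + det2 p (m i) / D * (m j).2).
  rewrite [p]surjective_pairing; move: D0.
  by rewrite /D /det2/= => ?; congr (_, _); field.
suff /andP[? ?] : (0 <= - det2 p (m j) / D) && (0 <= det2 p (m i) / D) by [].
have [D_lt0|D_gt0] : D < 0 \/ 0 < D by apply/orP; rewrite -neq_lt.
  apply/andP; split; last by rewrite mulr_le0// invr_le0 ltW.
  by rewrite mulNr oppr_ge0 mulr_ge0_le0// invr_le0 ltW.
have a0 : - det2 p (m j) / D <= 0 by rewrite pmulr_lle0 ?invr_gt0// oppr_le0.
have b0 : det2 p (m i) / D <= 0 by rewrite pmulr_lle0 ?invr_gt0.
have : dot2 l (- p) >= 0 by move: lp; rewrite /dot2/=; lra.
rewrite pE /dot2/=; move: a0 b0 (l0 i) (l0 j); rewrite /dot2.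
by move: (- det2 p (m j) / D) (det2 p (m i) / D) => a b; move=> *; apply/andP; split; nra.
Qed.

(** In the opposite cone, l(p) = 0 forces p = 0. With at least three columns the exponent is
    positive, so every term vanishes at the origin. *)
Lemma spline_boundary (n : nat) (m : 'I_n.+3 -> R * R) (l p : R * R) :
  (forall i j, i != j -> det2 (m i) (m j) != 0) ->
  (forall i, 0 < dot2 l (m i)) -> dot2 l p = 0 -> spline m p = 0.
Proof.
move=> mneq0 l0 lp.
have lp_le0 : dot2 l p <= 0 by rewrite lp.
have [pos|[neg|[i [j [a [b [ij a0 b0 pE]]]]]]] :=
  opposite_cone_or_same_side _ m l p mneq0 l0 lp_le0.
- by apply: spline_same_side => //; left.
- by apply: spline_same_side => //; right.
have : dot2 l (- p) = 0 by move: lp; rewrite /dot2/=; lra.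
rewrite pE /dot2/= => abE.
have := l0 i; have := l0 j; rewrite /dot2 => lj li.
have aeq0 : a = 0 by apply/eqP; rewrite eq_le a0 andbT; nra.
have beq0 : b = 0 by apply/eqP; rewrite eq_le b0 andbT; nra.
have p0 : p = 0.
  by apply: oppr_inj; rewrite pE aeq0 beq0 !mul0r addr0 oppr0.
rewrite /spline big1 ?mulr0// => k _; rewrite p0 /det2/= !mul0r subrr.
by rewrite /pos_power lexx subn2 expr0n mul0r.
Qed.

Lemma prod_det2_lift (n : nat) (m : 'I_n.+1 -> R * R) (i : 'I_n) :
  \prod_(j < n.+1 | j != lift ord0 i) det2 (m j) (m (lift ord0 i))
  = det2 (m ord0) (m (lift ord0 i))
    * \prod_(j < n | j != i) det2 (m (lift ord0 j)) (m (lift ord0 i)).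
Proof.
rewrite big_mkcond big_ord_recl/= -big_mkcondr; congr (_ * _).
Qed.

(** Termwise integration. The primitive of the i-th term contributes 1 / det(m_0, m_i), exactly the
    factor by which the product for one more column is longer, and its 1 / (n + 1) completes the
    factorial. The new term i = 0 is constant along the line, so it cancels in the difference. *)
Lemma integral_spline_line (n : nat) (m : 'I_n.+3 -> R * R) (p : R * R) (tau : R) :
  (forall i j, i != j -> det2 (m i) (m j) != 0) -> 0 < tau ->
  (\int[lebesgue_measure]_(t in `[0%R, tau])
     (spline (m \o lift ord0) (translate2 p (m ord0) (- t)))%:E
   = (spline m p - spline m (translate2 p (m ord0) (- tau)))%:E)%E.
Proof.
move=> mneq0 tau0.
have d0 i : det2 (m ord0) (m (lift ord0 i)) != 0 by rewrite mneq0// neq_lift.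
pose c (i : 'I_n.+2) : R := (n`!%:R)^-1
  / \prod_(j < n.+2 | j != i) det2 (m (lift ord0 j)) (m (lift ord0 i)).
pose w i := det2 p (m (lift ord0 i)); pose d i := det2 (m ord0) (m (lift ord0 i)).
have wE t i : det2 (translate2 p (m ord0) (- t)) (m (lift ord0 i)) = w i - t * d i.
  by rewrite /w /d /det2/=; ring.
transitivity (\int[lebesgue_measure]_(t in `[0%R, tau])
    \sum_(i < n.+2) ((c i)%:E * (pos_power (w i - t * d i) n)%:E))%E.
  apply: eq_integral => t _; rewrite /spline subn2/= mulr_sumr -sumEFin.
  apply: eq_bigr => i _; rewrite -EFinM wE; congr EFin.
  by rewrite /c mulrCA mulrC -!mulrA; congr (_ * _); rewrite mulrC.
have int_pp i := integrable_pos_power R n (w i) (d i) 0 tau (d0 i) tau0.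
rewrite integral_sum//; last first.
  by move=> i; apply: integrableZl => //; exact: int_pp.
under eq_bigr => i _.
  rewrite integralZl//.
  rewrite (integral_pos_power R n (w i) (d i) 0 tau (d0 i) tau0) mul0r subr0 -EFinM.
  over.
rewrite sumEFin; congr EFin.
rewrite /spline -mulrBr -sumrB [in RHS]big_ord_recl.
have -> : det2 (translate2 p (m ord0) (- tau)) (m ord0) = det2 p (m ord0).
  by rewrite /det2/=; ring.
rewrite subrr add0r mulr_sumr; apply: eq_bigr => i _.
rewrite prod_det2_lift wE -/(w i) -/(d i) -mulrBl subSS subn1/= /c factS natrM.
rewrite !invfM; set u := _ - _; set P := (\prod_(_ < _ | _) _)^-1.
by ring.
Qed.

End spline.

(** * The density and the effect of one more column *)

Section density.
Context (R : realType).

(** The G_n of the idea: cutting at the line l = 0 discards the values of the formula on the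
    opposite cone. *)
Definition spline_density (n : nat) (l : R * R) (m : 'I_n -> R * R) (p : R * R) : R :=
  if 0 < dot2 l p then spline m p else 0.

Arguments spline_density {n}.

Lemma measurable_det2l (q : R * R) : measurable_fun [set: R * R] (fun p => det2 p q).
Proof. by apply: measurable_funB; exact: measurable_funM. Qed.

Lemma measurable_dot2 (l : R * R) : measurable_fun [set: R * R] (dot2 l).
Proof. by apply: measurable_realfun.measurable_funD; exact: measurable_funM. Qed.

Lemma measurable_spline (n : nat) (m : 'I_n -> R * R) :
  measurable_fun [set: R * R] (spline m).
Proof.
apply: measurable_funM => //; apply: measurable_sum => i.
apply: measurable_funM => //.
exact: (measurableT_comp (@measurable_pos_power R (n - 2)) (measurable_det2l (m i))).
Qed.

Lemma measurable_spline_density (n : nat) (l : R * R) (m : 'I_n -> R * R) :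
  measurable_fun [set: R * R] (spline_density l m).
Proof.
apply: measurable_fun_ifT => //; last exact: measurable_spline.
by apply: measurable_fun_ltr => //; exact: measurable_dot2.
Qed.

Lemma measurable_translate2 (p v : R * R) :
  measurable_fun [set: R] (translate2 p v).
Proof.
by apply: measurable_fun_pair;
  apply: measurable_realfun.measurable_funD => //; exact: measurable_funM.
Qed.

Lemma spline_density_convolution (n : nat) (l : R * R) (m : 'I_n.+3 -> R * R)
    (p : R * R) :
  (forall i j, i != j -> det2 (m i) (m j) != 0) ->
  (forall i, 0 < dot2 l (m i)) ->
  (\int[lebesgue_measure]_t (if (0 <= t)%R then
     (spline_density l (m \o lift ord0) (translate2 p (m ord0) (- t)))%:E else 0)
   = (spline_density l m p)%:E)%E.
Proof.
move=> mneq0 l0.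
have dotE t : dot2 l (translate2 p (m ord0) (- t)) = dot2 l p - t * dot2 l (m ord0).
  by rewrite /dot2/=; ring.
rewrite /spline_density; have [lp|lp] := ltP 0 (dot2 l p); last first.
  (* Moving against m_0 only lowers l, so the ray never meets the half-plane l > 0. *)
  rewrite integral0_eq// => t _; case: ifP => // t0; rewrite dotE ifF//.
  by apply/negbTE; rewrite -leNgt; move: (l0 ord0) => ?; nra.
pose tau := dot2 l p / dot2 l (m ord0).
have tau0 : 0 < tau by rewrite divr_gt0.
have dot_gt0 t : (0 < dot2 l (translate2 p (m ord0) (- t))) = (t < tau).
  by rewrite dotE subr_gt0 /tau ltr_pdivlMr.
transitivity (\int[lebesgue_measure]_(t in `[0%R, tau[)
    (spline (m \o lift ord0) (translate2 p (m ord0) (- t)))%:E)%E.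
  rewrite [RHS]integral_mkcond; apply: eq_integral => t _.
  rewrite patchE mem_setE in_itv/= dot_gt0.
  by case: (0 <= t) => //=; case: ifP.
rewrite integral_itv_bndo_bndc; last first.
  apply: measurable_funTS.
  apply/measurable_EFinP; apply: measurableT_comp; first exact: measurable_spline.
  exact: (measurableT_comp (measurable_translate2 p (m ord0)) (@oppr_measurable R setT)).
rewrite integral_spline_line//.
have -> : spline m (translate2 p (m ord0) (- tau)) = 0.
  apply: (@spline_boundary _ _ _ l) => //.
  by rewrite dotE /tau divfK ?subrr// gt_eqF.
by rewrite subr0.
Qed.

Definition lincomb (n : nat) (m : 'I_n -> R * R) (u : 'I_n -> R) : R * R :=
  (\sum_i (m i).1 * u i, \sum_i (m i).2 * u i).

Arguments lincomb {n}.

Lemma measurable_lincomb (n : nat) (m : 'I_n -> R * R) :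
  measurable_fun [set: n.-tuple R] (fun u => lincomb m (tnth u)).
Proof.
by apply: measurable_fun_pair; apply: measurable_sum => i;
  apply: measurable_funM => //; exact: measurable_tnth.
Qed.

Lemma lincomb_cons (n : nat) (m : 'I_n.+1 -> R * R) (t : R) (v : n.-tuple R) :
  lincomb m (tnth [tuple of t :: v])
  = translate2 (lincomb (m \o lift ord0) (tnth v)) (m ord0) t.
Proof.
rewrite /lincomb /translate2 !big_ord_recl/= !tnth0.
congr (_, _); rewrite addrC [t * _]mulrC; congr (_ + _);
  by apply: eq_bigr => i _; rewrite tnthS.
Qed.

Lemma measurable_orthant (n : nat) : measurable (@orthant R n).
Proof.
have -> : @orthant R n = \bigcap_(i in [set: 'I_n]) ((@tnth n R)^~ i @^-1` `[0%R, +oo[).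
  apply/seteqP; split=> u /= H i; first by move=> _; rewrite /= in_itv/= andbT; exact: H.
  by have := H i I; rewrite /= in_itv/= andbT.
apply: fin_bigcap_measurable; first exact: finite_finset.
by move=> i _; rewrite -[_ @^-1` _]setTI; exact: measurable_tnth.
Qed.

Lemma orthant_cons (n : nat) (t : R) (v : n.-tuple R) :
  ([tuple of t :: v] \in @orthant R n.+1) = (0 <= t) && (v \in @orthant R n).
Proof.
apply/idP/andP => [/set_mem H|[t0 /set_mem H]].
  split; first by have := H ord0; rewrite tnth0.
  by apply/mem_set => i; have := H (lift ord0 i); rewrite tnthS.
apply/mem_set => i; case: (unliftP ord0 i) => [j ->|->]; first by rewrite tnthS; exact: H.
by rewrite tnth0.
Qed.

(** The inner integral depends on v only through the combination of the remaining columns, so it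
    serves as the new [phi] in an induction on the number of columns. *)
Lemma ge0_integral_orthantS (n : nat) (m : 'I_n.+1 -> R * R) (phi : R * R -> \bar R) :
  measurable_fun [set: R * R] phi -> (forall p, 0 <= phi p)%E ->
  (\int[lebesgue_tuple R n.+1]_(u in @orthant R n.+1) phi (lincomb m (tnth u))
   = \int[lebesgue_tuple R n]_(v in @orthant R n) \int[lebesgue_measure]_t
       (if (0 <= t)%R then
          phi (translate2 (lincomb (m \o lift ord0) (tnth v)) (m ord0) t) else 0))%E.
Proof.
move=> mphi phi0; rewrite integral_mkcond ge0_integral_lebesgue_tupleS.
- rewrite [RHS]integral_mkcond; apply: eq_integral => v _; rewrite patchE.
  under eq_integral => t _ do rewrite patchE orthant_cons lincomb_cons.
  case: (v \in _); first by under eq_integral => t _ do rewrite andbT.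
  by under eq_integral => t _ do rewrite andbF; rewrite integral0.
- have mphim := measurableT_comp mphi (measurable_lincomb n.+1 m).
  apply/(measurable_restrictT _ (@measurable_orthant n.+1)).
  exact: measurable_funTS mphim.
- by move=> u; rewrite patchE; case: ifP.
Qed.

End density.
Arguments spline_density {R n}.
Arguments lincomb {R n}.

(** * The integral identity for nonnegative functions *)

Section spline_integral.
Context (R : realType).

Lemma measurable_ray (v : R * R) (phi : R * R -> \bar R) :
  measurable_fun [set: R * R] phi -> (forall p, 0 <= phi p)%E ->
  measurable_fun [set: (R * R) * R] (fun z : (R * R) * R =>
    if (0 <= z.2)%R then phi (translate2 z.1 v z.2) else 0%E).
Proof.
move=> mphi phi0; apply: measurable_fun_ifT => //.
  by apply: measurable_fun_ler => //; exact: measurable_snd.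
apply: (measurableT_comp mphi).
have m1 : measurable_fun [set: (R * R) * R] (fun z => z.1.1).
  exact: (measurableT_comp measurable_fst measurable_fst).
have m2 : measurable_fun [set: (R * R) * R] (fun z => z.1.2).
  exact: (measurableT_comp measurable_snd measurable_fst).
by apply: measurable_fun_pair;
  apply: measurable_realfun.measurable_funD => //; apply: measurable_funM => //;
  exact: measurable_snd.
Qed.

Lemma measurable_integral_ray (v : R * R) (phi : R * R -> \bar R) :
  measurable_fun [set: R * R] phi -> (forall p, 0 <= phi p)%E ->
  measurable_fun [set: R * R] (fun p => \int[lebesgue_measure]_t
    (if (0 <= t)%R then phi (translate2 p v t) else 0))%E.
Proof.
move=> mphi phi0; have mray := measurable_ray v _ mphi phi0.
apply: (@measurable_fun_fubini_tonelli_F _ _ _ _ R (@lebesgue_measure R) _ mray).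
by move=> z; case: ifP.
Qed.

Lemma lebesgue_plane_swap (f : (R * R) * R -> \bar R) :
  measurable_fun [set: (R * R) * R] f -> (forall z, 0 <= f z)%E ->
  (\int[lebesgue_plane R]_p \int[lebesgue_measure]_t f (p, t)
   = \int[lebesgue_measure]_t \int[lebesgue_plane R]_p f (p, t))%E.
Proof.
move=> mf f0.
have plane_sigma_finite := product_sigma_finite _ _ _ _ R (@lebesgue_measure R)
  (@lebesgue_measure R) (sigma_finiteT _).
exact: (@fubini_tonelli _ _ _ _ R (sigma_finite_pack plane_sigma_finite)
  (@lebesgue_measure R) f mf f0).
Qed.

(* The orientation of the basis decides which boundary ray of the cone carries
   the value 0. *)
Lemma spline_density2E (l : R * R) (m : 'I_2 -> R * R) (s t : R) :
  let D := det2 (m ord0) (m ord_max) in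
  D != 0 -> (forall i, 0 < dot2 l (m i)) ->
  `|D| * spline_density l m
     (t * (m ord0).1 + s * (m ord_max).1, t * (m ord0).2 + s * (m ord_max).2)
  = if 0 < D then ((0 <= t) && (0 < s))%:R else ((0 < t) && (0 <= s))%:R.
Proof.
move=> D D0 l0; set p := (_, _).
have p0 : det2 p (m ord0) = - (s * D) by rewrite /D /det2/=; ring.
have p1 : det2 p (m ord_max) = t * D by rewrite /D /det2/=; ring.
have lp : dot2 l p = t * dot2 l (m ord0) + s * dot2 l (m ord_max).
  by rewrite /dot2/=; ring.
have ord01 : ord_max = lift ord0 ord0 :> 'I_2 by apply/val_inj.
(* With exponent 0 each term is an indicator divided by a determinant, and the two determinants are
   opposite. *)
have splineE : spline m p = ((0 <= t * D)%R%:R - (0 <= - (s * D))%R%:R) / D.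
  rewrite /spline subnn fact0 invr1 mul1r !big_ord_recl big_ord0 addr0.
  rewrite (big_pred1 ord_max); last by case=> -[|[|]].
  rewrite (big_pred1 ord0); last by case=> -[|[|]].
  rewrite -ord01 p0 p1 (det2C _ (m ord0) (m ord_max)) -/D invrN /pos_power !expr0.
  by rewrite mulrN mulrBl addrC; congr (_ / _ - _ / _); case: ifP.
have ds x : `|D| * (x / D) = x * Num.sg D.
  by rewrite normrEsg; rewrite mulrCA -mulrA divff// mulr1 mulrC.
rewrite /spline_density lp splineE.
(* Where l > 0, the quadrant on which the difference of indicators would give -1 is excluded; where
   l <= 0, the quadrant of the cone itself is excluded. *)
have := l0 ord0; have := l0 ord_max; move: (dot2 l _) (dot2 l _) => u v u0 v0.
have /orP[D_sign|D_sign] : (D < 0) || (0 < D) by rewrite -neq_lt.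
- rewrite [0 < D]ltNge (ltW D_sign)/=.
  have -> : (0 <= t * D) = (t <= 0) by rewrite nmulr_lge0.
  have -> : (0 <= - (s * D)) = (0 <= s) by rewrite oppr_ge0 nmulr_lle0.
  case: ltP => [pos|neg].
    rewrite ds ltr0_sg// mulrN1 opprB.
    case: (leP 0 s) => s0; case: (ltP 0 t) => t0; rewrite /= ?subr0 ?subrr//.
    by nra.
  rewrite mulr0; case: (leP 0 s) => s0; case: (ltP 0 t) => t0 //=.
  by nra.
- rewrite D_sign.
  have -> : (0 <= t * D) = (0 <= t) by rewrite pmulr_lge0.
  have -> : (0 <= - (s * D)) = (s <= 0) by rewrite oppr_ge0 pmulr_lle0.
  case: ltP => [pos|neg].
    rewrite ds gtr0_sg// mulr1.
    case: (leP 0 t) => t0; case: (ltP 0 s) => s0; rewrite /= ?subr0 ?subrr//.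
    by nra.
  rewrite mulr0; case: (leP 0 t) => t0; case: (ltP 0 s) => s0 //=.
  by nra.
Qed.

Lemma spline_density2_ge0 (l : R * R) (m : 'I_2 -> R * R) (p : R * R) :
  det2 (m ord0) (m ord_max) != 0 -> (forall i, 0 < dot2 l (m i)) ->
  0 <= spline_density l m p.
Proof.
move=> D0 l0; rewrite -(@pmulr_rge0 _ `|det2 (m ord0) (m ord_max)|) ?normr_gt0//.
have -> : p = (det2 p (m ord_max) / det2 (m ord0) (m ord_max) * (m ord0).1
               + det2 (m ord0) p / det2 (m ord0) (m ord_max) * (m ord_max).1,
               det2 p (m ord_max) / det2 (m ord0) (m ord_max) * (m ord0).2
               + det2 (m ord0) p / det2 (m ord0) (m ord_max) * (m ord_max).2).
  rewrite [LHS]surjective_pairing; move: D0.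
  by rewrite /det2/= => ?; congr (_, _); field.
by rewrite spline_density2E//; case: ifP => _; rewrite ler0n.
Qed.

(** In the coordinates (t, s) of the basis formed by the two columns, the density is 1 / |D| times
    the indicator of a half-open quadrant, and the Jacobian |D| cancels the constant. *)
Lemma ge0_integral_spline2 (l : R * R) (m : 'I_2 -> R * R) (phi : R * R -> \bar R) :
  (m ord0).1 != 0 -> det2 (m ord0) (m ord_max) != 0 ->
  (forall i, 0 < dot2 l (m i)) ->
  measurable_fun [set: R * R] phi -> (forall p, 0 <= phi p)%E ->
  (\int[lebesgue_tuple R 2]_(u in @orthant R 2) phi (lincomb m (tnth u))
   = \int[lebesgue_plane R]_p ((spline_density l m p)%:E * phi p))%E.
Proof.
move=> m0 D0 l0 mphi phi0; set D := det2 (m ord0) (m ord_max) in D0.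
pose K s t : \bar R :=
  phi (t * (m ord0).1 + s * (m ord_max).1, t * (m ord0).2 + s * (m ord_max).2).
have mK : measurable_fun [set: R * R] (fun z : R * R => K z.1 z.2).
  have := measurableT_comp mphi (measurable_affine_plane R
    (m ord_max).1 (m ord0).1 0 (m ord_max).2 (m ord0).2 0).
  congr measurable_fun; apply/funext => z; rewrite /= /K !addr0.
  by congr (phi (_, _)); ring.
have K0 s t : (0 <= K s t)%E by exact: phi0.
have mKs s : measurable_fun [set: R] (K s).
  exact: ((measurable_plane_line _ _ mK).1 s).
have mKpos s : measurable_fun [set: R] (fun t => if (0 <= t)%R then K s t else 0%E).
  by apply: measurable_fun_ifT => //; exact: measurable_fun_ler.
have ord01 : ord_max = lift ord0 ord0 :> 'I_2 by apply/val_inj.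
transitivity (\int[lebesgue_measure]_s (if (0 <= s)%R then
    \int[lebesgue_measure]_t (if (0 <= t)%R then K s t else 0) else 0))%E.
  rewrite ge0_integral_orthantS//.
  pose psi p := (\int[lebesgue_measure]_t
    (if (0 <= t)%R then phi (translate2 p (m ord0) t) else 0))%E.
  have psi0 p : (0 <= psi p)%E by apply: integral_ge0 => t _; case: ifP.
  rewrite (@ge0_integral_orthantS _ _ _ psi)//; last exact: measurable_integral_ray.
  rewrite integral_mkcond integral_lebesgue_tuple0 patchE mem_set; last by case.
  apply: eq_integral => s _; case: ifP => // _; apply: eq_integral => t _.
  case: ifP => // _; rewrite /K /translate2/= /lincomb !big_ord0/= !add0r.
  by rewrite -ord01 ![t * _ + _]addrC.
pose f p := ((`|D| * spline_density l m p)%:E * phi p)%E.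
have mdens := measurable_spline_density R 2 l m.
have mf : measurable_fun [set: R * R] f.
  by apply: emeasurable_funM => //; apply/measurable_EFinP; exact: measurable_funM.
have fE s t : f (t * (m ord0).1 + s * (m ord_max).1, t * (m ord0).2 + s * (m ord_max).2)
    = if (if 0 < D then (0 <= t) && (0 < s) else (0 < t) && (0 <= s)) then K s t else 0%E.
  rewrite /f spline_density2E// -/D; case: ifP => _; case: (_ && _);
    by rewrite ?mul1e ?mul0e.
have f0 p : (0 <= f p)%E.
  by rewrite /f mule_ge0// lee_fin mulr_ge0// spline_density2_ge0.
have -> : (fun p => (spline_density l m p)%:E * phi p)%E
    = (fun p => (`|D|^-1)%:E * f p)%E.
  apply/funext => p; rewrite /f muleA -EFinM mulrA mulVf ?mul1r//.
  by rewrite normr_eq0.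
rewrite ge0_integralZl//.
rewrite (ge0_integral_plane_linear R (m ord0) (m ord_max) f)// muleA -EFinM.
rewrite mulVf ?normr_eq0// mul1e.
under [RHS]eq_integral => s _ do under eq_integral => t _ do rewrite fE.
(* The strict inequality sits on the outer variable s if D > 0 and on the inner variable t
   otherwise; the null boundary is adjusted in the corresponding integral. *)
case: (ltP 0 D) => _.
  rewrite ge0_integral_half_line; last first.
    pose Kpos (z : R * R) := if 0 <= z.2 then K z.1 z.2 else 0%E.
    have mKpos2 : measurable_fun [set: R * R] Kpos.
      by apply: measurable_fun_ifT => //; apply: measurable_fun_ler.
    apply: (measurable_plane_integral _ Kpos mKpos2 _).1.
    by move=> z; rewrite /Kpos; case: ifP.
  apply: eq_integral => s _; case: ifP => s0.
    by under [RHS]eq_integral => t _ do rewrite andbT.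
  by under [RHS]eq_integral => t _ do rewrite andbF; rewrite integral0.
apply: eq_integral => s _; case: ifP => s0.
  rewrite ge0_integral_half_line//.
  by under [RHS]eq_integral => t _ do rewrite andbT.
by under [RHS]eq_integral => t _ do rewrite andbF; rewrite integral0.
Qed.

(** Nonnegativity is carried along in the induction: Tonelli's theorem uses it for the smaller
    family, and it passes to the larger one because the new density is an integral of the old one,
    whereas the terms of the formula have varying signs. *)
Theorem ge0_integral_spline (n : nat) (l : R * R) (m : 'I_n.+2 -> R * R) :
  (forall i, (m i).1 != 0) ->
  (forall i j, i != j -> det2 (m i) (m j) != 0) ->
  (forall i, 0 < dot2 l (m i)) ->
  (forall p, 0 <= spline_density l m p) /\
  forall phi : R * R -> \bar R,
    measurable_fun [set: R * R] phi -> (forall p, 0 <= phi p)%E ->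
    (\int[lebesgue_tuple R n.+2]_(u in @orthant R n.+2) phi (lincomb m (tnth u))
     = \int[lebesgue_plane R]_p ((spline_density l m p)%:E * phi p))%E.
Proof.
elim: n m => [|n IHn] m mx mneq0 l0.
  have D0 : det2 (m ord0) (m ord_max) != 0 by exact: mneq0.
  by split=> *; [exact: spline_density2_ge0|exact: ge0_integral_spline2].
have [|||dens0 IH] := IHn (m \o lift ord0).
- by move=> i; exact: mx.
- by move=> i j ij; apply: mneq0; rewrite (inj_eq lift_inj).
- by move=> i; exact: l0.
have conv := spline_density_convolution R n l m _ mneq0 l0.
have mdens := measurable_spline_density R n.+2 l (m \o lift ord0).
split=> [p|phi mphi phi0].
  rewrite -lee_fin -conv; apply: integral_ge0 => t _.
  by case: ifP => // _; rewrite lee_fin.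
rewrite ge0_integral_orthantS//.
pose psi p := (\int[lebesgue_measure]_t
  (if (0 <= t)%R then phi (translate2 p (m ord0) t) else 0))%E.
have psi0 p : (0 <= psi p)%E by apply: integral_ge0 => t _; case: ifP.
have mpsi : measurable_fun [set: R * R] psi by exact: measurable_integral_ray.
rewrite (IH psi)//.
pose d p := spline_density l (m \o lift ord0) p.
(* At each t >= 0, [G] is [F] translated by - t m_0: the shift moves from the test function to the
   density. *)
pose F p t : \bar R :=
  ((d p)%:E * (if (0 <= t)%R then phi (translate2 p (m ord0) t) else 0))%E.
pose G p t : \bar R :=
  ((if (0 <= t)%R then (d (translate2 p (m ord0) (- t)))%:E else 0) * phi p)%E.
have F0 p t : (0 <= F p t)%E.
  by rewrite /F mule_ge0// ?lee_fin ?dens0//; case: ifP.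
have G0 p t : (0 <= G p t)%E.
  by rewrite /G mule_ge0//; case: ifP => // _; rewrite lee_fin dens0.
have mF : measurable_fun [set: (R * R) * R] (fun z => F z.1 z.2).
  apply: emeasurable_funM; last exact: (measurable_ray _ _ mphi phi0).
  apply/measurable_EFinP; exact: (measurableT_comp mdens measurable_fst).
have mG : measurable_fun [set: (R * R) * R] (fun z => G z.1 z.2).
  apply: emeasurable_funM; last exact: (measurableT_comp mphi measurable_fst).
  have mEd : measurable_fun [set: R * R] (EFin \o d) by exact/measurable_EFinP.
  have Ed0 p : (0 <= (EFin \o d) p)%E by rewrite lee_fin dens0.
  (* The density factor of [G] is a ray function in the direction - m_0. *)
  have := measurable_ray (- (m ord0).1, - (m ord0).2) _ mEd Ed0.
  congr measurable_fun; apply/funext => z; case: ifP => // _.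
  by rewrite /translate2/= !mulrN !mulNr.
transitivity (\int[lebesgue_plane R]_p \int[lebesgue_measure]_t F p t)%E.
  apply: eq_integral => p _; rewrite /F ge0_integralZl//.
  - exact: (measurableT_comp (measurable_ray _ _ mphi phi0) (pair1_measurable p)).
  - by move=> t _; case: ifP.
  - by rewrite lee_fin dens0.
rewrite (lebesgue_plane_swap (fun z => F z.1 z.2) mF)//=.
transitivity (\int[lebesgue_measure]_t \int[lebesgue_plane R]_p G p t)%E.
  apply: eq_integral => t _; rewrite /F /G; case: (leP 0 t) => _; last first.
    by under eq_integral do rewrite mule0; under [RHS]eq_integral do rewrite mul0e.
  have mFt : measurable_fun [set: R * R]
      (fun p => ((d p)%:E * phi (translate2 p (m ord0) t))%E).
    apply: emeasurable_funM; first exact/measurable_EFinP.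
    apply: (measurableT_comp mphi).
    have := measurable_affine_plane R 1 0 (t * (m ord0).1) 0 1 (t * (m ord0).2).
    by congr measurable_fun; apply/funext => p; rewrite /= !mul1r !mul0r addr0 add0r.
  rewrite (ge0_integral_plane_translate _ (- t * (m ord0).1, - t * (m ord0).2) _ mFt); last first.
    by move=> p; rewrite mule_ge0// lee_fin dens0.
  apply: eq_integral => p _; congr (_ * phi _)%E.
  by rewrite [RHS]surjective_pairing /translate2/= !mulNr !subrK.
rewrite -(lebesgue_plane_swap (fun z => G z.1 z.2) mG)//=.
apply: eq_integral => p _; rewrite -conv /G ge0_integralZr//.
- apply: measurable_fun_ifT => //; first exact: measurable_fun_ler.
  apply/measurable_EFinP; apply: (measurableT_comp mdens).
  exact: (measurableT_comp (measurable_translate2 R p (m ord0)) (@oppr_measurable R setT)).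
- by move=> t _; case: ifP => // _; rewrite lee_fin dens0.
Qed.

End spline_integral.

(** * A linear form positive on the columns, and the opposite cone *)

Lemma lincombD (R : realType) (n : nat) (m : 'I_n -> R * R) (u v : 'I_n -> R) :
  lincomb m (fun k => u k + v k) = lincomb m u + lincomb m v.
Proof.
rewrite /lincomb; congr (_, _); rewrite -big_split/=;
  by apply: eq_bigr => i _; rewrite mulrDr.
Qed.

Lemma lincomb_delta (R : realType) (n : nat) (m : 'I_n -> R * R) (a : R) (i : 'I_n) :
  lincomb m (fun k => a * (k == i)%:R) = (a * (m i).1, a * (m i).2).
Proof.
rewrite /lincomb; congr (_, _); rewrite (bigD1 i)//= eqxx mulr1 [X in _ + X]big1 ?addr0.
- by rewrite mulrC.
- by move=> j /negbTE ->; rewrite !mulr0.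
- by rewrite mulrC.
- by move=> j /negbTE ->; rewrite !mulr0.
Qed.

Lemma dot2_lincomb (R : realType) (n : nat) (m : 'I_n -> R * R) (l : R * R)
    (u : 'I_n -> R) :
  dot2 l (lincomb m u) = \sum_i u i * dot2 l (m i).
Proof.
rewrite /dot2/= !mulr_sumr -big_split/=; apply: eq_bigr => i _; ring.
Qed.

(** The identity det(m_j, m_k) m_i + det(m_k, m_i) m_j + det(m_i, m_j) m_k = 0 with three positive
    coefficients, divided by their sum, would put the origin in the convex hull. *)
Lemma lincomb_triangle_neq0 (R : realType) (n : nat) (m : 'I_n -> R * R)
    (i j k : 'I_n) :
  ~ (exists u, [/\ forall i, 0 <= u i, \sum_i u i = 1 & lincomb m u = 0]) ->
  0 < det2 (m i) (m j) -> 0 < det2 (m j) (m k) -> ~ 0 < det2 (m k) (m i).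
Proof.
move=> hull ij jk ki; apply: hull.
pose s := det2 (m j) (m k) + det2 (m k) (m i) + det2 (m i) (m j).
have s0 : 0 < s by rewrite /s; lra.
exists (fun h => (det2 (m j) (m k) / s) * (h == i)%:R
  + (det2 (m k) (m i) / s) * (h == j)%:R + (det2 (m i) (m j) / s) * (h == k)%:R).
split.
- by move=> h; rewrite !addr_ge0// mulr_ge0// ?ler0n// ltW// divr_gt0.
- have delta a (h : 'I_n) : \sum_g a * (g == h)%:R = a :> R.
    rewrite (bigD1 h)//= eqxx mulr1 big1 ?addr0// => g /negbTE ->.
    by rewrite mulr0.
  by rewrite !big_split/= !delta -!mulrDl divff// gt_eqF.
rewrite !lincombD !lincomb_delta; apply/eqP; rewrite -pair_eqE/=; apply/andP.
by move: s0; rewrite /s /det2 => s0; split; apply/eqP; field; rewrite gt_eqF.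
Qed.

(** The relation det(m_i, m_j) > 0 is a tournament, transitive because cyclic triangles are
    excluded. Its source e and sink f are the extreme columns, and l = det(m_e, .) + det(., m_f) is
    positive on everything between them. *)
Lemma positive_functional (R : realType) (n : nat) (m : 'I_n.+2 -> R * R) :
  ~ (exists u, [/\ forall i, 0 <= u i, \sum_i u i = 1 & lincomb m u = 0]) ->
  (forall i j, i != j -> det2 (m i) (m j) != 0) ->
  exists l, forall i, 0 < dot2 l (m i).
Proof.
move=> hull mneq0.
pose r := [rel i j | 0 < det2 (m i) (m j)].
have rtot i j : i != j -> r i j || r j i.
  move=> /mneq0; rewrite /= neq_lt orbC [det2 (m j) _]det2C oppr_gt0.
  by [].
have rxx : irreflexive r by move=> i; rewrite /= det2xx ltxx.
have rtr : transitive r.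
  move=> j i k /= ij jk; have [ik|/rtot/orP[//|/= ki]] := eqVneq i k.
    by move: jk; rewrite -ik det2C oppr_gt0 ltNge ltW.
  by case: (@lincomb_triangle_neq0 _ _ m i j k hull ij jk ki).
have [e eP] := tournament_source _ r rxx rtr rtot.
have [f fP] : exists f, forall j, j != f -> r j f.
  apply: (tournament_source _ (fun i j => r j i)) => //.
  - by move=> j i k ji kj; exact: rtr kj ji.
  - by move=> i j ij; rewrite orbC; exact: rtot.
exists (- (m e).2 + (m f).2, (m e).1 - (m f).1) => i.
have -> : dot2 (- (m e).2 + (m f).2, (m e).1 - (m f).1) (m i)
    = det2 (m e) (m i) + det2 (m i) (m f) by rewrite /dot2 /det2/=; ring.
have ge_e : 0 <= det2 (m e) (m i).
  by have [->|/eP/ltW//] := eqVneq i e; rewrite det2xx.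
have ge_f : 0 <= det2 (m i) (m f).
  by have [->|/fP/ltW//] := eqVneq i f; rewrite det2xx.
(* One of the two terms is strictly positive unless i = e = f, and then any other column would come
   both after and before i. *)
have [ie|/eP/= ?] := eqVneq i e; last by rewrite ltr_wpDr.
have [if_|/fP/= ?] := eqVneq i f; last by rewrite ltr_wpDl.
have : exists k : 'I_n.+2, k != i by exists (lift i ord0); rewrite eq_sym neq_lift.
move=> [k ki]; have := eP k; have := fP k; rewrite -ie -if_ => /(_ ki) ik /(_ ki) ki'.
by have := rtr _ _ _ ik ki'; rewrite rxx.
Qed.

Lemma spline_outside_opposite_cone (R : realType) (n : nat) (m : 'I_n.+2 -> R * R)
    (l p : R * R) :
  (forall i j, i != j -> det2 (m i) (m j) != 0) ->
  (forall i, 0 < dot2 l (m i)) ->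
  ~ (exists2 u, forall i, 0 <= u i & lincomb m u = - p) ->
  spline m p = spline_density l m p.
Proof.
move=> mneq0 l0 ncone; rewrite /spline_density; have [//|lp] := ltP 0 (dot2 l p).
have [pos|[neg|[i [j [a [b [ij a0 b0 pE]]]]]]] :=
  opposite_cone_or_same_side _ _ m l p mneq0 l0 lp.
- by apply: spline_same_side => //; left.
- by apply: spline_same_side => //; right.
case: ncone; exists (fun k => a * (k == i)%:R + b * (k == j)%:R).
  by move=> k; rewrite addr_ge0// mulr_ge0.
by rewrite lincombD !lincomb_delta pE.
Qed.

Lemma spline_density_opposite_cone (R : realType) (n : nat) (m : 'I_n -> R * R)
    (l p : R * R) (u : 'I_n -> R) :
  (forall i, 0 < dot2 l (m i)) -> (forall i, 0 <= u i) -> lincomb m u = - p ->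
  spline_density l m p = 0.
Proof.
move=> l0 u0 uE; rewrite /spline_density ifF//; apply/negbTE; rewrite -leNgt.
have : 0 <= dot2 l (- p).
  by rewrite -uE dot2_lincomb sumr_ge0// => i _; rewrite mulr_ge0// ltW.
by rewrite /dot2/= !mulrN -opprD oppr_ge0.
Qed.

(** * Integer columns as real vectors, and the conclusion *)

Section columns_as_vectors.
Context (R : realType) (n : nat) (M : 'M[int]_(2, n)).

Definition column2 (i : 'I_n) : R * R := ((xcoord M i)%:~R, (ycoord M i)%:~R).

Lemma truncated_power_formulaE (p : R * R) :
  truncated_power_formula M p = spline column2 p.
Proof.
rewrite /truncated_power_formula /spline; congr (_ * _); apply: eq_bigr => i _.
rewrite /det2/= [p.1 * _]mulrC [p.2 * _]mulrC; congr (_ / _).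
by apply: eq_bigr => j _; rewrite /= rmorphB/= !rmorphM/= mulrC.
Qed.

Lemma slope_mono :
  (forall i j : 'I_n, nat_of_ord j = (nat_of_ord i).+1 -> slope M i < slope M j) ->
  forall i j : 'I_n, (i < j)%N -> slope M i < slope M j.
Proof.
move=> slope_lt i [j jn] /=; elim: j jn => // j IHj jn.
rewrite ltnS leq_eqVlt => /predU1P[ij|ij]; first by apply: slope_lt; rewrite ij.
by apply: lt_trans (IHj (ltnW jn) ij) _; exact: slope_lt.
Qed.

(** No column is vertical, so a vanishing minor would mean equal slopes, which strict monotonicity
    excludes. *)
Lemma det2_column2_neq0 :
  (forall i : 'I_n, xcoord M i != 0) ->
  (forall i j : 'I_n, nat_of_ord j = (nat_of_ord i).+1 -> slope M i < slope M j) ->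
  forall i j, i != j -> det2 (column2 i) (column2 j) != 0.
Proof.
move=> x0 /slope_mono mono i j ij.
rewrite /det2/= -!intrM -rmorphB intr_eq0 subr_eq0.
have /eqP : slope M i != slope M j.
  have := ij; rewrite -val_eqE neq_ltn => /orP[/mono|/mono]; first by move/lt_eqF ->.
  by move/gt_eqF ->.
apply: contra_not_neq => /= xy; apply/eqP.
rewrite /slope eqr_div ?intr_eq0 ?x0// -!intrM eqr_int.
by rewrite [X in X == _]mulrC [X in _ == X]mulrC; apply/eqP; rewrite mulrC -xy mulrC.
Qed.

End columns_as_vectors.

Lemma funepos_EFinM (R : realType) (T : Type) (d f : T -> R) (p : T) :
  0 <= d p -> ((fun p => (d p * f p)%:E)^\+ p = (d p)%:E * (EFin \o f)^\+ p)%E.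
Proof. by move=> d0; rewrite !funeposE/= -!EFin_max -EFinM maxr_pMr// mulr0. Qed.

Lemma funeneg_EFinM (R : realType) (T : Type) (d f : T -> R) (p : T) :
  0 <= d p -> ((fun p => (d p * f p)%:E)^\- p = (d p)%:E * (EFin \o f)^\- p)%E.
Proof. by move=> d0; rewrite !funenegE/= -!EFin_max -EFinM maxr_pMr// mulr0 mulrN. Qed.

Theorem theorem10 (R : realType) (n : nat) (n_ge2 : (2 <= n)%N)
    (M : 'M[int]_(2, n))
    (hull0 : ~ convex_hull_columns M ((0, 0) : R * R))
    (M_one_prime : one_prime M)
    (x_neq0 : forall i : 'I_n, xcoord M i != 0)
    (slope_lt : forall i j : 'I_n,
       nat_of_ord j = (nat_of_ord i).+1 -> slope M i < slope M j) :
  forall phi : R * R -> R, test_function phi ->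
    truncated_power M phi =
    (\int[lebesgue_plane R]_(p in [set p : R * R | ~ cone M (- p)%R])
       (truncated_power_formula M p * phi p)%R%:E)%E.
Proof.
move=> phi [/(_ 0%N)[cphi _] _].
have mphi : measurable_fun [set: R * R] (EFin \o phi).
  by apply/measurable_EFinP; exact: continuous_plane_measurable.
case: n n_ge2 M hull0 x_neq0 slope_lt {M_one_prime}
  => [|[|n]]// _ M hull0 x0 slope_lt.
pose m := column2 R n.+2 M.
have mneq0 := det2_column2_neq0 R n.+2 M x0 slope_lt.
have mx i : (m i).1 != 0 by rewrite intr_eq0.
have [l l0] : exists l, forall i, 0 < dot2 l (m i).
  apply: positive_functional => // -[u [u0 u1 uE]].
  by apply: hull0; exists u.
have [dens0 main] := ge0_integral_spline R n l m mx mneq0 l0.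
rewrite [RHS]integral_mkcond.
(* Off the opposite cone the formula agrees with the density; on it l <= 0, so the density is 0,
   like the restricted integrand. *)
have -> : ((fun p => (truncated_power_formula M p * phi p)%R%:E)
    \_ [set p : R * R | ~ cone M (- p)%R])%E
    = (fun p => (spline_density l m p * phi p)%:E).
  apply/funext => p; rewrite patchE; case: ifPn => [/set_mem ncone|/negP ncone].
    rewrite truncated_power_formulaE (spline_outside_opposite_cone _ _ _ l)//.
  have [u u0 uE] : cone M (- p).
    by apply: contrapT => ?; apply: ncone; exact/mem_set.
  by rewrite (spline_density_opposite_cone _ _ m l p u)// mul0r.
(* Both integrals are differences of the integrals of positive and negative parts. The nonnegative
   density factors out of each part, which makes each an instance of [main]. *)
rewrite /truncated_power [LHS]integralE [RHS]integralE.
congr (_ - _)%E.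
- under [RHS]eq_integral => p _ do rewrite funepos_EFinM//.
  rewrite -main//; last exact: measurable_funepos.
  by apply: eq_integral => u _; rewrite !funeposE.
- under [RHS]eq_integral => p _ do rewrite funeneg_EFinM//.
  rewrite -main//; last exact: measurable_funeneg.
  by apply: eq_integral => u _; rewrite !funenegE.
Qed.
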